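(* Let $X,Y$ be real Banach spaces, $A\subseteq X$ a nonempty compact convex set, $C\subseteq Y$ a closed convex cone with nonempty interior, and $F:X\to Y$ a continuous linear map with $F(X)\cap\operatorname{int}C\neq\emptyset$. Let $\theta$ be the associated merit function, assumed to satisfy $\theta(x)<+\infty$ for all $x\in X$, and let $\bar x\in E_w$. Set $$W(\bar x)=\{y^*\in K: F^*y^*\in -N_A(\bar x)\},\qquad W(\bar x)^+=\{z\in Y:\langle y^*,z\rangle\ge0\ \forall y^*\in W(\bar x)\}.$$ Then: (i) For any $d\in X$, $\theta'(\bar x;d)=\min_{y^*\in W(\bar x)}\langle y^*,F(d)\rangle$. (ii) $W(\bar x)$ is a nonempty weak$^*$-compact convex set, and $C\subseteq W(\bar x)^+\subseteq Y$. (iii) For any $d\in X$, $\theta'(\bar x;d)<0$ if and only if $F(d)\notin W(\bar x)^+$. (iv) The cone $D(\bar x):=\{d\in X:\theta'(\bar x;d)=0\}$ satisfies $$D(\bar x)=\Bigl\{d\in X:\min_{y^*\in W(\bar x)}\langle y^*,F(d)\rangle=0\Bigr\}=F^{-1}\bigl(\operatorname{bd}(W(\bar x)^+)\bigr),$$ where $\operatorname{bd}$ denotes the topological boundary in $Y$.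
   Context: $d_D(y)=\inf_{u\in D}\|y-u\|$ with $d_\emptyset\equiv+\infty$; $\Delta_D(y)=d_D(y)-d_{Y\setminus D}(y)$ with conventions $\Delta_\emptyset\equiv+\infty$, $\Delta_Y\equiv-\infty$. $C^+=\{y^*\in Y^*:\langle y^*,c\rangle\ge 0\ \forall c\in C\}$, $S(C^+)=\{y^*\in C^+:\|y^*\|=1\}$, $K=\overline{\operatorname{co}}^{w^*}(S(C^+))$ (weak$^*$-closed convex hull in $Y^*$). $F^*:Y^*\to X^*$ is the adjoint of $F$. The merit function is $$\theta(x)=\sup_{a\in A}\bigl(-\Delta_C(F(x)-F(a))\bigr)=\sup_{a\in A}\inf_{y^*\in S(C^+)}\langle y^*,F(x)-F(a)\rangle .$$ $E_w=\{\bar x\in A: F(\bar x)\notin F(A)+\operatorname{int}C\}$ is the weakly efficient solution set. $N_A(x)=\{x^*\in X^*:\langle x^*,y-x\rangle\le0\ \forall y\in A\}$ is the normal cone. $\theta'(x;d)=\lim_{t\downarrow0}\frac{\theta(x+td)-\theta(x)}{t}$, which exists and is finite since $\theta$ is concave and Lipschitz. *)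

(* Defs.v *)
From HB Require Import structures.
#[warnings="-all"] From mathcomp Require Export all_boot all_order all_algebra.
#[warnings="-all"] From mathcomp Require Export all_classical all_reals all_analysis.

Set Implicit Arguments.
Unset Strict Implicit.
Unset Printing Implicit Defensive.

Import Order.TTheory GRing.Theory Num.Theory.
Import numFieldNormedType.Exports.

Local Open Scope classical_set_scope.
Local Open Scope ring_scope.

Definition continuous_linear_form (R : realType) (E : normedModType R) :
    {pred E -> R^o} :=
  fun f => `[< linear f /\ continuous f >].

Lemma continuous_linear_form_submod (R : realType) (E : normedModType R) :
  submod_closed (@continuous_linear_form R E).
Proof.
split.
  apply/asboolP; split; last exact: cst_continuous.
  by move=> a u v /=; rewrite -[LHS]/(0 : R^o) -[RHS]/(a *: (0 : R^o) + 0) scaler0 addr0.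
move=> a f g /asboolP[lf cf] /asboolP[lg cg]; apply/asboolP; split.
  move=> b u v; rewrite -[LHS]/(a *: f (b *: u + v) + g (b *: u + v)).
  rewrite -[RHS]/(b *: (a *: f u + g u) + (a *: f v + g v)) lf lg.
  by rewrite !scalerDr !scalerA (mulrC a b) addrACA.
move=> x; apply: (@continuousD R R^o E (fun y => a *: f y)); last exact: cg.
by apply: continuousZl_tmp; exact: cf.
Qed.

HB.instance Definition _ (R : realType) (E : normedModType R) :=
  GRing.isSubmodClosed.Build R (E -> R^o) (@continuous_linear_form R E)
    (@continuous_linear_form_submod R E).

Record dual (R : realType) (E : normedModType R) := Dual {
  dual_val : E -> R^o;
  dual_valP : dual_val \in @continuous_linear_form R E }.

Definition dual_fun (R : realType) (E : normedModType R) (f : dual E) : E -> R :=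
  dual_val f.
Coercion dual_fun : dual >-> Funclass.

HB.instance Definition _ (R : realType) (E : normedModType R) :=
  [isSub for @dual_val R E].
HB.instance Definition _ (R : realType) (E : normedModType R) :=
  [Choice of dual E by <:].
HB.instance Definition _ (R : realType) (E : normedModType R) :=
  [SubChoice_isSubLmodule of dual E by <:].

(* [dual E] carries the weak* topology (pointwise convergence on E), not the
   norm topology. *)
HB.instance Definition _ (R : realType) (E : normedModType R) :=
  Topological.copy (dual E)
    (initial_topology (@dual_fun R E : dual E -> {ptws E -> R})).

(* The real [sup] is the true one: the set is nonempty, and bounded because f is
   continuous. *)
Definition dual_norm (R : realType) (E : normedModType R) (f : dual E) : R :=
  sup [set `|f u| | u in [set u : E | `|u| <= 1]].

Lemma adjoint_subproof (R : realType) (E G : normedModType R)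
    (F : {linear E -> G}) (cF : continuous F) (f : dual G) :
  (fun x => dual_val f (F x)) \in @continuous_linear_form R E.
Proof.
have /asboolP[lf cf] := dual_valP f; apply/asboolP; split.
  by move=> a u v; rewrite linearP lf.
by move=> x; apply: continuous_comp; [exact: cF | exact: cf].
Qed.

Definition adjoint (R : realType) (E G : normedModType R)
    (F : {linear E -> G}) (cF : continuous F) (f : dual G) : dual E :=
  Dual (adjoint_subproof cF f).

Definition is_cone (R : realType) (E : lmodType R) (C : set E) :=
  forall (t : R) (x : E), 0 <= t -> C x -> C (t *: x).

Definition boundary (T : topologicalType) (A : set T) : set T :=
  closure A `\` interior A.

Definition is_min (R : realType) (S : set R) (m : R) := S m /\ lbound S m.

(* The infimum over the empty set is +oo. *)
Definition dist_set (R : realType) (E : normedModType R) (D : set E) (y : E) :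
    \bar R :=
  ereal_inf [set `|y - u|%:E | u in D].

(* When D is empty this is +oo - 0 = +oo, and when D is the whole space it is
   0 - (+oo) = -oo, so the usual conventions hold without a case distinction. *)
Definition oriented_dist (R : realType) (E : normedModType R) (D : set E)
    (y : E) : \bar R :=
  (dist_set D y - dist_set (~` D) y)%E.

Definition merit (R : realType) (X Y : normedModType R) (A : set X)
    (C : set Y) (F : X -> Y) (x : X) : \bar R :=
  ereal_sup [set (- oriented_dist C (F x - F a)%R)%E | a in A].

Definition weakly_efficient (R : realType) (X Y : normedModType R) (A : set X)
    (C : set Y) (F : X -> Y) : set X :=
  [set x | A x /\ ~ [set u + c | u in F @` A & c in interior C] (F x)].

Definition normal_cone (R : realType) (X : normedModType R) (A : set X)
    (x : X) : set (dual X) :=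
  [set f | forall y, A y -> f (y - x) <= 0].

Definition diff_quot (R : realType) (X : normedModType R) (f : X -> \bar R)
    (x d : X) (t : R) : \bar R :=
  ((f (x + t *: d)%R - f x) * t^-1%:E)%E.

Definition dir_derivable (R : realType) (X : normedModType R)
    (f : X -> \bar R) (x d : X) :=
  cvg (diff_quot f x d t @[t --> 0^'+]).

Definition dir_deriv (R : realType) (X : normedModType R) (f : X -> \bar R)
    (x d : X) : \bar R :=
  lim (diff_quot f x d t @[t --> 0^'+]).

Definition pos_dual_cone (R : realType) (Y : normedModType R) (C : set Y) :
    set (dual Y) :=
  [set f | forall c, C c -> 0 <= f c].

Definition dual_cone_sphere (R : realType) (Y : normedModType R) (C : set Y) :
    set (dual Y) :=
  [set f | pos_dual_cone C f /\ dual_norm f = 1].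

Definition convex_hull (R : realType) (E : lmodType R) (S : set E) : set E :=
  smallest (@convex_set R E) S.

(* The closure is taken in [dual Y], hence in the weak* topology. *)
Definition sphere_hull (R : realType) (Y : normedModType R) (C : set Y) :
    set (dual Y) :=
  closure (convex_hull (dual_cone_sphere C)).

Definition multipliers (R : realType) (X Y : normedModType R) (A : set X)
    (C : set Y) (F : {linear X -> Y}) (cF : continuous F) (x : X) :
    set (dual Y) :=
  [set f | sphere_hull C f /\ (-%R @` normal_cone A x) (adjoint cF f)].

Definition pre_dual_cone (R : realType) (Y : normedModType R)
    (W : set (dual Y)) : set Y :=
  [set z | forall f : dual Y, W f -> 0 <= f z].

(* Main.v *)
(* Separating points from C (Hahn-Banach) shows that -Delta_C is the infimum of
   the forms of S(C^+), hence of K, which is weak*-compact by Banach-Alaoglu. At a weakly efficient point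
   theta vanishes, and every y* in W gives theta(xbar + t d) <= t <y*, F d>.
   Conversely, if every y* in W satisfies <y*, F d> > c, then for every y* in K
   some direction z = d + r (xbar - a), with r > 0 and a in A, satisfies
   <y*, F z> > c; by minimax one z works for all of K up to a weak inequality,
   and since xbar + t d - t z lies in A for small t, theta(xbar + t d) >= t c.
   With d = 0 and c = 1 this also forces W to be nonempty. The boundary formula
   holds because forms of K are positive on int C and 1-Lipschitz. *)
From HB Require Import structures.
Require Import Defs.
From mathcomp Require Import finmap ring lra.

Set Implicit Arguments.
Unset Strict Implicit.
Unset Printing Implicit Defensive.

Import Order.TTheory GRing.Theory Num.Theory.
Import numFieldNormedType.Exports.

Local Open Scope classical_set_scope.
Local Open Scope ring_scope.

(** * The Hahn-Banach theorem *)

Section HahnBanach.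
Context (R : realType) (V : lmodType R).
Implicit Types (q : V -> R) (x v : V).

(** Only an inequality for positive factors is required, which is easy to check for infima; equality
    and the factor 0 follow. *)
Definition sublinear q :=
  (forall x y, q (x + y) <= q x + q y) /\
  (forall (s : R) x, 0 < s -> q (s *: x) <= s * q x).

Lemma sublinearZ q (s : R) x : sublinear q -> 0 <= s -> q (s *: x) = s * q x.
Proof.
move=> [_ qZ]; rewrite le_eqVlt => /orP[/eqP<-|s0].
  have h2 : 0 < 2^-1 :> R by rewrite invr_gt0.
  have h := qZ _ (0 : V) h2; have h' := qZ 2 (0 : V) (ltr0Sn _ _).
  move: h h'; rewrite !scaler0 !scale0r mul0r => h h'.
  apply/eqP; rewrite eq_le; apply/andP; split; lra.
apply/eqP; rewrite eq_le qZ//=.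
have si0 : 0 < s^-1 by rewrite invr_gt0.
have := qZ _ (s *: x) si0; rewrite scalerA mulVf ?gt_eqF// scale1r.
by rewrite ler_pdivlMl.
Qed.

Lemma sublinear_opp_ge q x : sublinear q -> - q (- x) <= q x.
Proof.
move=> qs; have := qs.1 x (- x).
by rewrite subrr -(scale0r x) sublinearZ// mul0r; lra.
Qed.

(** For odd [q], subadditivity at [x + y] and [- y] gives the reverse inequality. *)
Lemma sublinear_odd_linear q : sublinear q -> (forall x, q (- x) <= - q x) ->
  linear (q : V -> R^o).
Proof.
move=> qs qN.
have qNE x : q (- x) = - q x.
  by apply/eqP; rewrite eq_le qN/=; have := sublinear_opp_ge x qs; lra.
have qD x y : q (x + y) = q x + q y.
  apply/eqP; rewrite eq_le qs.1/=.
  by have := qs.1 (x + y) (- y); rewrite addrK qNE; lra.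
move=> s x y; rewrite qD; congr (_ + _).
have [s0|s0] := leP 0 s; first exact: sublinearZ.
rewrite -[s]opprK scaleNr qNE sublinearZ//; last by rewrite oppr_ge0 ltW.
by rewrite -[RHS]/(- - s * q x) -mulNr.
Qed.

(** For sublinear [q], the largest sublinear functional below [q] whose value at [- v] is at most
    [- q v]. *)
Definition tilt q v x :=
  inf [set q (x + t *: v) - t * q v | t in [set t : R | 0 <= t]].

Lemma tilt_has_inf q v x : sublinear q ->
  has_inf [set q (x + t *: v) - t * q v | t in [set t : R | 0 <= t]].
Proof.
move=> qs; split; first by exists (q (x + 0 *: v) - 0 * q v), 0 => /=.
exists (- q (- x)) => _ [t /= t0 <-].
have := qs.1 (x + t *: v) (- x).
by rewrite addrAC subrr add0r sublinearZ//; lra.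
Qed.

Lemma tilt_le q v x (t : R) : sublinear q -> 0 <= t ->
  tilt q v x <= q (x + t *: v) - t * q v.
Proof.
by move=> qs t0; apply: ge_inf; [exact: (tilt_has_inf v x qs).2|exists t].
Qed.

Lemma le_tilt q v x (r : R) : sublinear q ->
  (forall t, 0 <= t -> r <= q (x + t *: v) - t * q v) -> r <= tilt q v x.
Proof.
move=> qs h; apply: lb_le_inf; first exact: (tilt_has_inf v x qs).1.
by move=> _ [t /= t0 <-]; exact: h.
Qed.

Lemma tilt_sublinear q v : sublinear q -> sublinear (tilt q v).
Proof.
move=> qs; split=> [x y|s x s0].
  rewrite -lerBlDr; apply: le_tilt => // t t0.
  rewrite lerBlDr -lerBlDl; apply: le_tilt => // u u0.
  rewrite lerBlDl; apply: (le_trans (tilt_le v (x + y) qs (addr_ge0 t0 u0))).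
  have := qs.1 (x + t *: v) (y + u *: v).
  by rewrite addrACA -scalerDl; lra.
rewrite -ler_pdivrMl//; apply: le_tilt => // t t0.
rewrite ler_pdivrMl//.
apply: (le_trans (tilt_le v (s *: x) qs (mulr_ge0 (ltW s0) t0))).
rewrite -scalerA -scalerDr sublinearZ ?(ltW s0)//.
by rewrite mulrBr mulrA.
Qed.

Lemma tilt_le_id q v x : sublinear q -> tilt q v x <= q x.
Proof.
move=> qs; have := tilt_le v x qs (lexx 0).
by rewrite scale0r addr0 mul0r subr0.
Qed.

Lemma tiltN q v : sublinear q -> tilt q v (- v) <= - q v.
Proof.
move=> qs; have := tilt_le v (- v) qs ler01.
by rewrite scale1r addNr -(scale0r v) sublinearZ// !mul0r mul1r sub0r.
Qed.

(** Zorn's lemma applies: the pointwise infimum of a nonempty chain is finite, since [- q (- x)]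
    bounds its values at [x] from below, and it is again sublinear. *)
Lemma exists_minimal_sublinear q : sublinear q ->
  exists m, [/\ sublinear m, forall x, m x <= q x &
    forall m', sublinear m' -> (forall x, m' x <= m x) -> m' = m].
Proof.
move=> qs.
pose T := {m : V -> R | sublinear m /\ forall x, m x <= q x}.
(* The order is reversed, so that maximal for [le] means pointwise minimal. *)
pose le (a b : T) : bool := `[< forall x, proj1_sig b x <= proj1_sig a x >].
have [| | | |[m [ms mq]] mmin] := @Zorn T le.
- by move=> a; apply/asboolP.
- move=> a b c /asboolP ab /asboolP bc; apply/asboolP => x.
  exact: le_trans (bc x) (ab x).
- move=> [a Pa] [b Pb] /asboolP/= ab /asboolP/= ba.
  apply: eq_exist; apply/funext => x; apply/eqP; rewrite eq_le.
  by rewrite ba ab.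
- move=> A Atot; have [[a0 Aa0]|A0] := pselect (A !=set0); last first.
    exists (exist _ q (conj qs (fun x => lexx _))) => s As.
    by case: A0; exists s.
  pose S x := [set proj1_sig a x | a in A].
  have Sinf x : has_inf (S x).
    split; first by exists (proj1_sig a0 x), a0.
    exists (- q (- x)) => _ [a Aa <-].
    have [as_ aq] := proj2_sig a.
    by have := sublinear_opp_ge x as_; have := aq (- x); lra.
  pose i x := inf (S x).
  have ile a x : A a -> i x <= proj1_sig a x.
    by move=> Aa; apply: ge_inf; [exact: (Sinf x).2|exists a].
  have lei r x : (forall a, A a -> r <= proj1_sig a x) -> r <= i x.
    move=> h; apply: lb_le_inf; first exact: (Sinf x).1.
    by move=> _ [a Aa <-]; exact: h.
  have is_ : sublinear i.
    split=> [x y|s x s0].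
      rewrite -lerBlDr; apply/lei => a Aa.
      rewrite lerBlDr -lerBlDl; apply/lei => b Ab.
      rewrite lerBlDl.
      (* One functional must serve both arguments: the smaller of [a] and [b] does. *)
      have [/asboolP ab|/asboolP ab] := Atot _ _ Aa Ab.
        apply: (le_trans (ile b (x + y) Ab)).
        apply: (le_trans ((proj2_sig b).1.1 x y)).
        by rewrite lerD2r.
      apply: (le_trans (ile a (x + y) Aa)).
      apply: (le_trans ((proj2_sig a).1.1 x y)).
      by rewrite lerD2l.
    rewrite -ler_pdivrMl//; apply/lei => a Aa; rewrite ler_pdivrMl//.
    exact: le_trans (ile a _ Aa) ((proj2_sig a).1.2 _ _ s0).
  have iq x : i x <= q x by apply: le_trans (ile a0 x Aa0) ((proj2_sig a0).2 x).
  exists (exist _ i (conj is_ iq)) => a Aa; apply/asboolP => x /=.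
  exact: ile.
exists m; split=> // m' m's m'm.
have m'q x : m' x <= q x by apply: le_trans (m'm x) (mq x).
have /= := mmin (exist _ m' (conj m's m'q)).
by move=> /(_ (asboolT m'm)) /(congr1 (@proj1_sig _ _)).
Qed.

(* A minimal sublinear functional coincides with all its tilts, hence is odd. *)
Lemma minimal_sublinear_linear q : sublinear q ->
  exists f : V -> R^o, linear f /\ forall x, f x <= q x.
Proof.
move=> /exists_minimal_sublinear[m [ms mq mmin]]; exists m; split=> //.
apply: sublinear_odd_linear => // v.
rewrite -{1}(mmin _ (tilt_sublinear v ms)) ?tiltN// => x.
exact: tilt_le_id.
Qed.

(** A linear [f] below [tilt q v] satisfies [f (- v) <= - q v], that is, [q v <= f v]. *)
Theorem hahn_banach q v : sublinear q ->
  exists f : V -> R^o, [/\ linear f, forall x, f x <= q x & f v = q v].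
Proof.
move=> qs; have [f [fl fq]] := minimal_sublinear_linear (tilt_sublinear v qs).
have fle x : f x <= q x by exact: le_trans (fq x) (tilt_le_id v x qs).
exists f; split=> //; apply/eqP; rewrite eq_le fle/=.
have fN : f (- v) = - f v.
  have := fl (-1) (0 : V) 0; rewrite !scaleN1r oppr0 addr0 addNr => f0.
  by have := fl (-1) v 0; rewrite !scaleN1r f0 !addr0.
by have := le_trans (fq (- v)) (tiltN v qs); rewrite fN; lra.
Qed.

End HahnBanach.

(** * Convexity through explicit weights *)

Section ConvexSets.
Context (R : realType) (V : lmodType R).

Lemma convex_setP (A : set V) : @convex_set R V A <->
  forall x y s t, A x -> A y -> 0 <= s -> 0 <= t -> s + t = 1 ->
    A (s *: x + t *: y).
Proof.
split=> [cA x y s t Ax Ay s0 t0 st|cA x y l /set_mem Ax /set_mem Ay].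
  have s1 : s <= 1 by lra.
  have /set_mem := cA x y (Itv01 s0 s1) (mem_set Ax) (mem_set Ay).
  by rewrite /conv/= /unstable.onem -st addrAC subrr add0r.
apply/mem_set/cA => //; rewrite /unstable.onem; first by rewrite subr_ge0.
by rewrite addrC subrK.
Qed.

End ConvexSets.

(** * The weak* topology and the Banach-Alaoglu theorem *)

Section Dual.
Context (R : realType) (E : normedModType R).
Implicit Types (f g : dual E) (x y : E).

Lemma dual_linear f : linear (f : E -> R^o).
Proof. by have /asboolP[] := dual_valP f. Qed.

HB.instance Definition _ f :=
  GRing.isLinear.Build R E R^o _ (f : E -> R^o) (dual_linear f).

Lemma dual_continuous f : continuous (f : E -> R^o).
Proof. by have /asboolP[] := dual_valP f. Qed.

Lemma dualD f x y : f (x + y) = f x + f y.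
Proof. exact: (linearD (f : E -> R^o)). Qed.

Lemma dualZ f (s : R) x : f (s *: x) = s * f x.
Proof. exact: (linearZ_LR (f : E -> R^o)). Qed.

Lemma dualN f x : f (- x) = - f x.
Proof. exact: (linearN (f : E -> R^o)). Qed.

Lemma dualB f x y : f (x - y) = f x - f y.
Proof. exact: (linearB (f : E -> R^o)). Qed.

Lemma dual0 f : f 0 = 0.
Proof. exact: (linear0 (f : E -> R^o)). Qed.

Lemma dual_combE (s t : R) f g x : (s *: f + t *: g) x = s * f x + t * g x.
Proof. by []. Qed.

Lemma dual_has_sup f : has_sup [set `|f u| | u in [set u : E | `|u| <= 1]].
Proof.
split; first by exists `|f 0|, 0 => //=; rewrite normr0.
have := continuous_linear_bounded 0 (@dual_continuous f 0).
move=> /bounded_funP/(_ 1)[M hM].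
by exists M => _ [u /= u1 <-]; exact: hM.
Qed.

Lemma dual_le_norm f x : `|f x| <= dual_norm f * `|x|.
Proof.
have [->|x0] := eqVneq x 0; first by rewrite dual0 !normr0 mulr0.
have nx0 : 0 < `|x| by rewrite normr_gt0.
rewrite -ler_pdivrMr//; apply: sup_upper_bound; first exact: dual_has_sup.
exists (`|x|^-1 *: x) => /=.
  by rewrite normrZ ger0_norm ?invr_ge0// mulVf ?gt_eqF.
by rewrite dualZ normrM ger0_norm ?invr_ge0// mulrC.
Qed.

Lemma dual_norm_le f (M : R) : (forall u, `|u| <= 1 -> f u <= M) ->
  dual_norm f <= M.
Proof.
move=> h; apply: ge_sup; first exact: (dual_has_sup f).1.
move=> _ [u /= u1 <-]; rewrite ler_norml h// andbT lerNl -dualN.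
by apply: h; rewrite normrN.
Qed.

Lemma dual_eval_continuous x : continuous (fun f : dual E => f x).
Proof.
move=> f; have cval : continuous (@dual_fun R E : dual E -> {ptws E -> R}).
  exact: initial_continuous.
exact: (continuous_comp (cval f) (@proj_continuous E (fun=> R) x (dual_fun f))).
Qed.

Lemma dual_cvgP (F : set_system (dual E)) f : Filter F ->
  (forall x, (fun g : dual E => g x) @ F --> f x) -> F --> f.
Proof.
move=> FF h; have : {ptws, (@dual_fun R E) @ F --> (f : E -> R)}.
  by apply/pointwise_cvgP => x; exact: h.
move=> hF A [_ [[B oB <-] Bf BA]].
by apply: filterS BA _; apply: hF; rewrite nbhsE; exists B.
Qed.

(** The bound is an extended real so that it can later be [- oriented_dist C y] without a finiteness
    argument. *)
Lemma closed_dual_ge x (r : \bar R) :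
  closed [set f : dual E | (r <= (f x)%:E)%E].
Proof.
case: r => [r| |].
- under eq_set do rewrite lee_fin.
  apply: (@preimage_closed _ _ (fun f : dual E => f x) [set s | r <= s]) => //.
  by move=> f _; exact: dual_eval_continuous.
- rewrite (_ : [set _ | _] = set0); first exact: closed0.
  by apply/seteqP; split=> f //=; rewrite leye_eq.
- rewrite (_ : [set _ | _] = setT); first exact: closedT.
  by apply/seteqP; split=> f //= _; rewrite leNye.
Qed.

Lemma convex_dual_ge x (r : \bar R) :
  @convex_set R (dual E) [set f : dual E | (r <= (f x)%:E)%E].
Proof.
apply/convex_setP => f g s t /=; case: r => [r| |]; last 2 first.
- by rewrite leye_eq.
- by move=> *; exact: leNye.
rewrite !lee_fin => rf rg s0 t0 st; rewrite -[leRHS]/(s * f x + t * g x).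
have : s * r + t * r = r by rewrite -mulrDl st mul1r.
by have := ler_wpM2l s0 rf; have := ler_wpM2l t0 rg; lra.
Qed.

Lemma comb_continuous (s t : R) g :
  continuous (fun f : dual E => s *: f + t *: g).
Proof.
move=> f; apply: dual_cvgP => [|x]; first exact/fmap_filter/nbhs_filter.
have affc : continuous (fun r : R => s * r + t * g x).
  by move=> r; apply: cvgD; [exact: mulrl_continuous|exact: cvg_cst].
exact: (continuous_comp (@dual_eval_continuous x f) (affc (f x))).
Qed.

(** The combination is continuous in one form at a time, so the two closure points are replaced by
    points of [H] one after the other. *)
Lemma convex_closure (H : set (dual E)) :
  @convex_set R (dual E) H -> @convex_set R (dual E) (closure H).
Proof.
move=> /convex_setP cH; apply/convex_setP => f g s t Hf Hg s0 t0 st.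
have step (a b : R) (h k : dual E) : closure H h ->
    (forall h', H h' -> closure H (a *: h' + b *: k)) ->
    closure H (a *: h + b *: k).
  move=> Hh sub; apply: (@closed_closure _ H) => B nB.
  have [h' [Hh' Bh']] := Hh _ (@comb_continuous a b k h _ nB).
  by exists (a *: h' + b *: k); split=> //; exact: sub.
apply: (step s t f g Hf) => f' Hf'; rewrite addrC.
apply: (step t s g f' Hg) => g' Hg'.
by rewrite addrC; apply: subset_closure; exact: cH.
Qed.

(** Along an ultrafilter on the dual unit ball the values at each [x] converge, by compactness of a
    segment; the pointwise limit is linear and bounded, hence lies in [dual E]. *)
Lemma banach_alaoglu : compact [set f : dual E | forall x, `|f x| <= `|x|].
Proof.
rewrite compact_ultra => F UF FB.
have cvgx x : exists2 r : R, `|r| <= `|x| & (fun f : dual E => f x) @ F --> r.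
  have cI := @segment_compact R (- `|x|) `|x|.
  have FI : F [set f : dual E | `[- `|x|, `|x|]%classic (f x)].
    by apply: filterS FB => f /(_ x); rewrite ler_norml /= in_itv.
  have [r [rI clr]] := cI ((fun f : dual E => f x) @ F) _ FI.
  exists r; first by move: rI; rewrite ler_norml /= in_itv.
  move=> U nU /=.
  have [//|FU] := in_ultra_setVsetC ((fun f : dual E => f x) @^-1` U) UF.
  have [s [/= sU Us]] := clr (~` U) U FU nU.
  by case: sU.
pose phi x := projT1 (cid2 (cvgx x)).
have phi_le x : `|phi x| <= `|x| by rewrite /phi; case: cid2.
have phi_cvg x : (fun f : dual E => f x) @ F --> phi x.
  by rewrite /phi; case: cid2.
have phil : linear (phi : E -> R^o).
  move=> s x y; apply: (@cvg_unique _ (@Rhausdorff R)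
    ((fun f : dual E => f (s *: x + y)) @ F)).
    exact: phi_cvg.
  suff : (fun f : dual E => s * f x + f y) @ F --> s * phi x + phi y.
    apply: cvg_trans; apply: near_eq_cvg; apply: filterE => f.
    by rewrite dualD dualZ.
  by apply: cvgD; [apply: cvgM; [exact: cvg_cst|]|]; exact: phi_cvg.
pose phiL := GRing.isLinear.Build R E R^o _ _ phil.
pose phi' : {linear E -> R^o} := HB.pack phi phiL.
have phic : continuous (phi : E -> R^o).
  apply: (@bounded_linear_continuous _ _ _ phi'); apply/bounded_funP => r.
  by exists r => x xr; exact: le_trans (phi_le x) xr.
have phiP : phi \in @continuous_linear_form R E by apply/asboolP.
exists (Dual phiP); split; first exact: phi_le.
by apply: dual_cvgP => x; exact: phi_cvg.
Qed.

End Dual.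

(** * A minimax theorem *)

Section Minimax.
Context (R : realType) (Y : normedModType R).
Implicit Types (K : set (dual Y)) (Z : set Y) (z : Y) (c : R).

(** A form below [c] at [z2] bounds the weight of [z1] from below, one below [c] at [z1] bounds it
    from above. By [cross] these bounds are compatible, so the supremum of the lower bounds is a
    valid weight. *)
Lemma convex_alternative2 K z1 z2 c : @convex_set R (dual Y) K ->
  (forall f, K f -> c <= f z1 \/ c <= f z2) ->
  exists s t, [/\ 0 <= s, 0 <= t, s + t = 1 &
    forall f, K f -> c <= f (s *: z1 + t *: z2)].
Proof.
move=> /convex_setP cK alt.
have cross f g : K f -> K g -> f z1 < c -> g z2 < c ->
    (g z2 - c) * (f z1 - c) <= (g z1 - c) * (f z2 - c).
  move=> Kf Kg f1 g2; rewrite leNgt; apply/negP => lt.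
  have f2 : c <= f z2 by case: (alt f Kf); lra.
  have g1 : c <= g z1 by case: (alt g Kg); lra.
  (* These weights put both values of the mixture of [f] and [g] below [c]. *)
  pose a := (g z1 - c) - (g z2 - c); pose b := (f z2 - c) - (f z1 - c).
  have a0 : 0 < a by rewrite /a; lra.
  have b0 : 0 < b by rewrite /b; lra.
  have ab0 : 0 < a + b by lra.
  have Kh : K ((a / (a + b)) *: f + (b / (a + b)) *: g).
    apply: cK => //; try by rewrite divr_ge0// ltW.
    by rewrite -mulrDl divff// gt_eqF.
  by have := alt _ Kh; rewrite !dual_combE ![_ / _ * _]mulrAC -!mulrDl;
    rewrite !ler_pdivlMr//; rewrite /a /b; case; nra.
(* The lower bounds on the weight of [z1]; adding 0 makes [L] nonempty with nonnegative supremum. *)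
pose L := [set l : R | l = 0 \/
  exists2 g, K g /\ g z2 < c & l = (c - g z2) / (g z1 - g z2)].
have Lle1 : ubound L 1.
  move=> _ [->//|[g [Kg g2] ->]].
  have g1 : c <= g z1 by case: (alt g Kg); lra.
  by rewrite ler_pdivrMr; lra.
have L0 : L 0 by left.
have Lsup : has_sup L by split; [exists 0|exists 1].
exists (sup L), (1 - sup L).
have s0 : 0 <= sup L by exact: (ub_le_sup Lsup.2 L0).
have s1 : sup L <= 1 by apply: ge_sup => //; exists 0.
split => //; first by rewrite subr_ge0.
  by rewrite addrC subrK.
move=> f Kf; rewrite dualD !dualZ.
have [f2|f2] := ltP (f z2) c.
  have f1 : c <= f z1 by case: (alt f Kf); lra.
  have : (c - f z2) / (f z1 - f z2) <= sup L.
    by apply: (ub_le_sup Lsup.2); right; exists f.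
  by rewrite ler_pdivrMr; [lra|lra].
have [f1|f1] := ltP (f z1) c; last by nra.
have : sup L <= (f z2 - c) / (f z2 - f z1).
  apply: ge_sup; first by exists 0.
  move=> _ [->|[g [Kg g2] ->]]; first by rewrite divr_ge0//; lra.
  have g1 : c <= g z1 by case: (alt g Kg); lra.
  have := cross f g Kf Kg f1 g2.
  rewrite ler_pdivrMr; last lra.
  rewrite mulrAC ler_pdivlMr; last lra.
  nra.
by rewrite ler_pdivlMr; lra.
Qed.

Lemma convex_alternative K Z (s : seq Y) z0 c :
  @convex_set R (dual Y) K -> @convex_set R Y Z ->
  Z z0 -> (forall z, z \in s -> Z z) ->
  (forall f, K f -> exists2 z, z \in z0 :: s & c <= f z) ->
  exists2 z, Z z & forall f, K f -> c <= f z.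
Proof.
move=> cK cZ Zz0; elim: s K cK => [|z1 s IH] K cK Zs alt.
  by exists z0 => // f /alt[z]; rewrite inE => /eqP->.
have [|||z Zz Kz] := IH (K `&` [set f | f z1 < c]).
- move/convex_setP: cK => cK; apply/convex_setP.
  move=> f g a b [Kf /= f1] [Kg /= g1] a0 b0 ab.
  split; first exact: cK.
  rewrite -[ltLHS]/(a * f z1 + b * g z1).
  have [a_0|an0] := eqVneq a 0; first by rewrite a_0 mul0r add0r; nra.
  have a_gt0 : 0 < a by rewrite lt_neqAle eq_sym an0.
  by nra.
- by move=> z zs; apply: Zs; rewrite inE zs orbT.
- move=> f [/alt[z]]; rewrite !inE => /or3P[/eqP->|/eqP->|zs] cz /= f1.
  + by exists z0; rewrite ?inE ?eqxx.
  + by move: f1; rewrite ltNge cz.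
  + by exists z; rewrite ?inE ?zs ?orbT.
have [|a [b [a0 b0 ab h]]] := @convex_alternative2 K z1 z c cK.
  move=> f Kf; have [f1|f1] := ltP (f z1) c; [right|by left].
  exact: Kz.
exists (a *: z1 + b *: z) => //.
by move/convex_setP: cZ; apply => //; apply: Zs; rewrite inE eqxx.
Qed.

(** The sets where [c < f z] are weak* open and cover [K]; a finite subcover reduces the claim to
    finitely many points. *)
Theorem minimax K Z z0 c : compact K -> @convex_set R (dual Y) K ->
  @convex_set R Y Z -> Z z0 ->
  (forall f, K f -> exists2 z, Z z & c < f z) ->
  exists2 z, Z z & forall f, K f -> c <= f z.
Proof.
move=> Kc cK cZ Zz0 alt.
pose T : ptopologicalType := HB.pack (dual Y) (isPointed.Build (dual Y) 0).
move: (Kc); rewrite (_ : compact K = @compact T K)// compact_cover.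
move=> /(_ Y Z (fun z => [set f : dual Y | c < f z])).
case=> [z Zz||D DZ Kcov].
- rewrite -[open _]/(open ((fun f : dual Y => f z) @^-1` [set r | c < r])).
  apply: open_comp; last exact: open_gt.
  by move=> f _; exact: dual_eval_continuous.
- by move=> f /alt[z Zz cz]; exists z.
apply: (@convex_alternative K Z (enum_fset D) z0 c) => //.
  by move=> z zD; apply/set_mem/DZ.
move=> f /Kcov[z /= zD /ltW cz].
by exists z => //; rewrite inE zD orbT.
Qed.

End Minimax.

(** * The oriented distance and the hull K *)

Section OrientedDistance.
Context (R : realType) (Y : normedModType R).
Implicit Types (C D : set Y) (f : dual Y) (y z : Y) (r : R).

Lemma dist_set_ge0 D y : (0 <= dist_set D y)%E.
Proof.
by apply: le_ereal_inf_tmp => _ [u Du <-]; rewrite lee_fin.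
Qed.

Lemma dist_set_mem D y : D y -> dist_set D y = 0%E.
Proof.
move=> Dy; apply/eqP; rewrite eq_le dist_set_ge0 andbT.
by apply: ereal_inf_lbound; exists y => //; rewrite subrr normr0.
Qed.

Lemma oriented_dist_in C y : C y -> oriented_dist C y = (- dist_set (~` C) y)%E.
Proof. by move=> Cy; rewrite /oriented_dist dist_set_mem// sub0e. Qed.

Lemma oriented_dist_out C y : ~ C y -> oriented_dist C y = dist_set C y.
Proof.
by move=> nCy; rewrite /oriented_dist (@dist_set_mem (~` C))// sube0.
Qed.

Lemma oriented_dist_ge0 C y : ~ interior C y -> (0 <= oriented_dist C y)%E.
Proof.
move=> nCy; have [Cy|/oriented_dist_out->] := pselect (C y); last first.
  exact: dist_set_ge0.
rewrite oriented_dist_in// leeNr oppe0 leNgt; apply/negP => d0; apply: nCy.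
have [e e0 ed] : exists2 e : R, 0 < e & (e%:E <= dist_set (~` C) y)%E.
  case: (dist_set (~` C) y) d0 => [r| |] //.
    by rewrite lte_fin => r0; exists r.
  by move=> _; exists 1; rewrite ?leey.
apply/nbhs_normP; exists e => //= z /= yz; apply: contrapT => nCz.
have : (dist_set (~` C) y <= `|y - z|%:E)%E.
    by apply: ereal_inf_lbound; exists z.
by move=> /(le_trans ed); rewrite lee_fin leNgt yz.
Qed.

(** Outside [C], [f y >= f (y - c) >= - |y - c|] for every [c] in [C]. Inside, if [f y < r] and the
    ball of radius [r] about [y] lies in [C], then [f u <= f y / r] on the unit ball, so the norm of
    [f] is below 1. *)
Lemma dual_cone_sphere_le C f y :
  dual_cone_sphere C f -> (- oriented_dist C y <= (f y)%:E)%E.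
Proof.
move=> [fC f1].
have fle u : `|f u| <= `|u| by have := dual_le_norm f u; rewrite f1 mul1r.
have [Cy|nCy] := pselect (C y); last first.
  rewrite oriented_dist_out// leeNl -EFinN.
  apply: le_ereal_inf_tmp => _ [c Cc <-]; rewrite lee_fin.
  have := fle (y - c); rewrite dualB ler_norml => /andP[h _].
  by have := fC _ Cc; lra.
rewrite oriented_dist_in// oppeK leNgt; apply/negP => fyd.
have fy0 : 0 <= f y by exact: fC.
have [r fyr rd] : exists2 r : R, f y < r & (r%:E < dist_set (~` C) y)%E.
  case: (dist_set (~` C) y) fyd => [d| |] //.
    rewrite lte_fin => fyd; exists ((f y + d) / 2); last rewrite lte_fin; lra.
  by move=> _; exists (f y + 1); rewrite ?ltry//; lra.
have r0 : 0 < r by lra.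
have Cball u : `|u| <= 1 -> C (y - r *: u).
  move=> u1; apply: contrapT => nCu.
  have : (dist_set (~` C) y <= `|y - (y - r *: u)|%:E)%E.
    by apply: ereal_inf_lbound; exists (y - r *: u).
  move=> /(lt_le_trans rd).
  rewrite lte_fin opprB addrC subrK normrZ gtr0_norm//.
  by nra.
suff : dual_norm f <= f y / r by rewrite f1 ler_pdivlMr// mul1r; lra.
apply: dual_norm_le => u /Cball/fC; rewrite dualB dualZ ler_pdivlMr//.
lra.
Qed.

(** * Separation from the closed convex cone [C] *)

Context (C : set Y) (C_closed : closed C) (C_convex : @convex_set R Y C)
  (C_cone : is_cone C) (C_neq0 : C !=set0).

Lemma cone0 : C 0.
Proof. by have [c Cc] := C_neq0; rewrite -(scale0r c); exact: C_cone. Qed.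

Lemma coneD x y : C x -> C y -> C (x + y).
Proof.
move=> Cx Cy; have -> : x + y = 2 *: (2^-1 *: x + 2^-1 *: y).
  by rewrite scalerDr !scalerA divff// !scale1r.
apply: C_cone => //; move/convex_setP: C_convex; apply => //; lra.
Qed.

(** The distance from [- z] to [C]. It vanishes on [- C], so a linear functional below it is
    nonnegative on [C]. *)
Let p z := inf [set `|z + c| | c in C].

Let p_has_inf z : has_inf [set `|z + c| | c in C].
Proof.
split; first by have [c Cc] := C_neq0; exists `|z + c|, c.
by exists 0 => _ [c _ <-].
Qed.

Let p_le z c : C c -> p z <= `|z + c|.
Proof. by move=> Cc; apply: ge_inf; [exact: (p_has_inf z).2|exists c]. Qed.

Let le_p z r : (forall c, C c -> r <= `|z + c|) -> r <= p z.
Proof.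
move=> h; apply: lb_le_inf; first exact: (p_has_inf z).1.
by move=> _ [c Cc <-]; exact: h.
Qed.

Let p_sublinear : sublinear p.
Proof.
split=> [x y|s x s0].
  rewrite -lerBlDr; apply: le_p => c Cc.
  rewrite lerBlDr -lerBlDl; apply: le_p => d Cd.
  rewrite lerBlDl; apply: (le_trans (p_le (x + y) (coneD Cc Cd))).
  by rewrite addrACA ler_normD.
rewrite -ler_pdivrMl//; apply: le_p => c Cc; rewrite ler_pdivrMl//.
apply: (le_trans (p_le (s *: x) (C_cone (ltW s0) Cc))).
by rewrite -scalerDr normrZ gtr0_norm.
Qed.

(** Hahn-Banach at [- z] gives a form below [p] whose value there is the distance from [z] to
    [C]. *)
Lemma separate_cone z : ~ C z ->
  exists2 f, dual_cone_sphere C f & (dist_set C z <= (- f z)%:E)%E.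
Proof.
move=> nCz; have [f [fl fp fz]] := hahn_banach (- z) p_sublinear.
pose fL := GRing.isLinear.Build R Y R^o _ _ fl.
pose f' : {linear Y -> R^o} := HB.pack f fL.
have f_le u : f u <= `|u|.
  by apply: le_trans (fp u) _; rewrite -[u in leRHS]addr0; exact/p_le/cone0.
have fN u : f (- u) = - f u := linearN f' u.
have fabs u : `|f u| <= `|u|.
  by rewrite ler_norml f_le andbT lerNl -fN -(normrN u) f_le.
have fc : continuous f.
  apply: (@bounded_linear_continuous _ _ _ f'); apply/bounded_funP => r.
  by exists r => x xr; exact: le_trans (fabs x) xr.
have fP : f \in @continuous_linear_form R Y by apply/asboolP.
pose g := Dual fP; have gE u : g u = f u by [].
have gC : pos_dual_cone C g.
  move=> c Cc; rewrite gE -oppr_le0 -fN (le_trans (fp _))//.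
  by rewrite (le_trans (p_le _ Cc))// addNr normr0.
have d_gt0 : 0 < p (- z).
  have /nbhs_normP[e /= e0 zC] : nbhs z (~` C).
    by apply: open_nbhs_nbhs; split => //; exact: closed_openC.
  apply: (lt_le_trans e0); apply: le_p => c Cc.
  by rewrite leNgt (addrC (- z)) distrC; apply/negP => /zC /=; apply.
exists g; last first.
  rewrite gE -fN fz /p -ereal_inf_EFin; last 2 first.
    exact: (p_has_inf (- z)).2.
    exact: (p_has_inf (- z)).1.
  apply: le_ereal_inf_tmp => _ [_ [c Cc <-] <-].
  by apply: ereal_inf_lbound; exists c => //; rewrite (addrC (- z)) distrC.
split=> //; apply/eqP; rewrite eq_le; apply/andP; split.
  by apply: dual_norm_le => u u1; exact: le_trans (f_le u) u1.
(* Taking the infimum over [c] gives [p (- z) <= dual_norm g * p (- z)]; as [p (- z)] is positive,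
   the norm is at least 1. *)
have dle c : C c -> p (- z) <= dual_norm g * `|- z + c|.
  move=> Cc; rewrite -fz -gE; have := dual_le_norm g (- z + c).
  rewrite ler_norml => /andP[_]; apply: le_trans.
  by rewrite dualD lerDl; exact: gC.
have N0 : 0 < dual_norm g.
  have [c Cc] := C_neq0; have := lt_le_trans d_gt0 (dle _ Cc).
  by have := normr_ge0 (- z + c); nra.
have : p (- z) / dual_norm g <= p (- z).
  by apply: le_p => c /dle; rewrite ler_pdivrMr// mulrC.
by rewrite ler_pdivrMr// -[leLHS]mulr1 ler_pM2l.
Qed.

(** For [y] in [C] and [z] outside, the form separating [z] is nonpositive at [z], so
    [r <= f y <= f (y - z) <= |y - z|]. For [y] outside [C], the form separating [y] suffices. *)
Lemma le_oriented_dist y r :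
  (forall f, dual_cone_sphere C f -> r <= f y) ->
  (r%:E <= - oriented_dist C y)%E.
Proof.
move=> rle; have [Cy|nCy] := pselect (C y); last first.
  rewrite oriented_dist_out//.
  have [f Sf df] := separate_cone nCy.
  by rewrite leeNr (le_trans df)// lee_fin lerN2 rle.
rewrite oriented_dist_in// oppeK; apply: le_ereal_inf_tmp => _ [z nCz <-].
have [f Sf df] := separate_cone nCz; rewrite lee_fin.
have fz : f z <= 0.
  by have := le_trans (dist_set_ge0 C z) df; rewrite lee_fin oppr_ge0.
have := dual_le_norm f (y - z); rewrite Sf.2 mul1r dualB ler_norml => /andP[_].
by have := rle f Sf; lra.
Qed.

(** The half-space of forms is weak* closed and convex, so a bound passes from the sphere to its
    hull. *)
Lemma sphere_hull_ind (y : Y) (r : \bar R) :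
  (forall f, dual_cone_sphere C f -> (r <= (f y)%:E)%E) ->
  sphere_hull C `<=` [set f : dual Y | (r <= (f y)%:E)%E].
Proof.
move=> h; rewrite /sphere_hull closureE; apply: smallest_sub.
  exact: closed_dual_ge.
apply: smallest_sub; first exact: convex_dual_ge.
by move=> g; exact: h.
Qed.

Lemma sphere_hull_convex : @convex_set R (dual Y) (sphere_hull C).
Proof.
apply: convex_closure; apply/convex_setP => f g s t Hf Hg s0 t0 st H [cH SH].
by move/convex_setP: (cH); apply => //; [exact: Hf|exact: Hg].
Qed.

Lemma sub_sphere_hull : dual_cone_sphere C `<=` sphere_hull C.
Proof.
by apply: subset_trans (@subset_closure _ _); exact: sub_gen_smallest.
Qed.

Lemma sphere_hull_le_oriented_dist f y :
  sphere_hull C f -> (- oriented_dist C y <= (f y)%:E)%E.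
Proof. by apply: sphere_hull_ind => g; exact: dual_cone_sphere_le. Qed.

Lemma sphere_hull_ge0 f y : sphere_hull C f -> C y -> 0 <= f y.
Proof.
move=> Kf Cy; rewrite -lee_fin; apply: sphere_hull_ind Kf => g [gC _].
by rewrite lee_fin gC.
Qed.

Lemma sphere_hull_le_norm f y : sphere_hull C f -> `|f y| <= `|y|.
Proof.
move=> Kf; have ge z : - `|z| <= f z.
  rewrite -lee_fin; apply: sphere_hull_ind Kf => g [_ g1].
  have := dual_le_norm g z; rewrite g1 mul1r ler_norml lee_fin.
  by case/andP.
by rewrite ler_norml ge/= -[f y]opprK -dualN lerNl -(normrN y) ge.
Qed.

(** A ball of radius [s] about [e] inside [C] gives [s <= g e] on the whole sphere; this uniform
    bound, unlike strict positivity, survives weak* closure. *)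
Lemma sphere_hull_gt0 f e : interior C e -> sphere_hull C f -> 0 < f e.
Proof.
move=> /nbhs_normP[r /= r0 eC] Kf.
have [s s0 sr] : exists2 s, 0 < s & s < r by exists (r / 2); lra.
apply: (lt_le_trans s0); rewrite -lee_fin.
apply: sphere_hull_ind Kf => g [gC g1].
suff : dual_norm g <= g e / s by rewrite lee_fin g1 ler_pdivlMr// mul1r.
apply: dual_norm_le => u u1.
rewrite ler_pdivlMr// mulrC -dualZ -subr_ge0 -dualB; apply: gC; apply: eC => /=.
by rewrite opprB addrC subrK normrZ gtr0_norm//; nra.
Qed.

Lemma sphere_hull_compact : compact (sphere_hull C).
Proof.
apply: (subclosed_compact _ (@banach_alaoglu R Y)); first exact: closed_closure.
by move=> f Kf y; exact: sphere_hull_le_norm.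
Qed.

End OrientedDistance.

(** * The directional derivative of the merit function *)

Section MeritDerivative.
Context (R : realType) (X Y : normedModType R)
  (A : set X) (C : set Y) (F : {linear X -> Y}) (cF : continuous F)
  (A_convex : @convex_set R X A)
  (C_closed : closed C) (C_convex : @convex_set R Y C) (C_cone : is_cone C)
  (C_int : interior C !=set0)
  (xbar : X) (xbar_weff : weakly_efficient A C F xbar).

Local Notation theta := (merit A C F).
Local Notation K := (sphere_hull C).
Local Notation W := (multipliers A C cF xbar).
Local Notation Wp := (pre_dual_cone W).

Let C_neq0 : C !=set0.
Proof. by have [e /interior_subset Ce] := C_int; exists e. Qed.

Let A_xbar : A xbar := xbar_weff.1.

(** The normal cone condition is the first-order optimality of [xbar] for the linear function
    [f \o F] on [A]. *)
Lemma multipliersP f : W f <-> K f /\ forall a, A a -> f (F xbar) <= f (F a).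
Proof.
split=> [[Kf [g gN fE]]|[Kf fmin]]; split=> //.
  move=> a Aa; rewrite -subr_ge0 -dualB -linearB.
  have -> : f (F (a - xbar)) = adjoint cF f (a - xbar) by [].
  rewrite -fE; have -> : (- g : dual X) (a - xbar) = - g (a - xbar) by [].
  by rewrite oppr_ge0; exact: gN.
exists (- adjoint cF f); last by rewrite opprK.
move=> a Aa.
have -> : (- adjoint cF f : dual X) (a - xbar) = - f (F (a - xbar)) by [].
by rewrite linearB dualB oppr_le0 subr_ge0; exact: fmin.
Qed.

Lemma multipliers_setI :
  W = K `&`
    \bigcap_(a in A) [set f : dual Y | (0%:E <= (f (F a - F xbar))%:E)%E].
Proof.
apply/seteqP; split=> f.
  move=> /multipliersP[Kf fmin]; split=> // a Aa.
  by rewrite /= lee_fin dualB subr_ge0 fmin.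
move=> [Kf fmin]; apply/multipliersP; split=> // a Aa.
by have := fmin a Aa; rewrite /= lee_fin dualB subr_ge0.
Qed.

Lemma multipliers_compact : compact W.
Proof.
rewrite multipliers_setI; apply: compact_closedI.
  exact: sphere_hull_compact.
by apply: closed_bigI => a _; exact: closed_dual_ge.
Qed.

Lemma multipliers_convex : @convex_set R (dual Y) W.
Proof.
apply/convex_setP => f g s t /multipliersP[Kf fm] /multipliersP[Kg gm] s0 t0 st.
apply/multipliersP; split.
  by move/convex_setP: (@sphere_hull_convex R Y C); apply.
move=> a Aa; rewrite !dual_combE lerD//; apply: ler_wpM2l => //.
  exact: fm.
exact: gm.
Qed.

(** Weak efficiency keeps [F xbar - F a] out of [interior C], so no [a] gives a positive value;
    [a = xbar] gives a nonnegative one. *)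
Lemma merit_xbar : theta xbar = 0%E.
Proof.
apply/eqP; rewrite eq_le; apply/andP; split.
  apply: ge_ereal_sup => _ [a Aa <-]; rewrite leeNl oppe0.
  apply: oriented_dist_ge0 => h; apply: xbar_weff.2.
  exists (F a); first by exists a.
  by exists (F xbar - F a) => //; rewrite addrC subrK.
apply: (@le_trans _ _ (- oriented_dist C (F xbar - F xbar)%R)%E).
  by apply: le_oriented_dist => // f _; rewrite subrr dual0.
by apply: ereal_sup_ubound; exists xbar.
Qed.

(** A multiplier makes [f (F xbar - F a)] nonpositive, leaving only the term in [d]. *)
Lemma merit_le f d (t : R) : W f -> 0 <= t ->
  (theta (xbar + t *: d)%R <= (t * f (F d))%:E)%E.
Proof.
move=> /multipliersP[Kf fm] t0; apply: ge_ereal_sup => _ [a Aa <-].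
apply: (le_trans (sphere_hull_le_oriented_dist _ Kf)).
rewrite lee_fin dualB linearD linearZ dualD dualZ.
by have := fm a Aa; lra.
Qed.

(* Minimax over the cone of feasible displacements: a lower bound on the
   multipliers alone is realized uniformly on K by a single direction
   d + r (xbar - a), and xbar + t d differs from a point of A by t times it. *)
Lemma merit_ge d (c : R) : (forall f, W f -> c < f (F d)) ->
  exists2 s : R, 0 < s & forall t, 0 < t -> t <= s ->
    ((t * c)%:E <= theta (xbar + t *: d)%R)%E.
Proof.
move=> Wc.
pose Z := [set z | exists r a, [/\ 0 < r, A a & z = F (d + r *: (xbar - a))]].
have ZFd : Z (F d) by exists 1, xbar; rewrite subrr scaler0 addr0.
have Zconvex : @convex_set R Y Z.
  apply/convex_setP => _ _ u v [r [a [r0 Aa ->]]] [q [b [q0 Ab ->]]] u0 v0 uv.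
  (* With this total weight the displacements [xbar - a] and [xbar - b] merge into [w] times one
     from a single point of [A]. *)
  pose w := u * r + v * q.
  have w0 : 0 < w.
    have [v_0|vn0] := eqVneq v 0.
      by rewrite /w v_0 mul0r addr0 mulr_gt0//; lra.
    by rewrite ltr_wpDl ?mulr_gt0 ?mulr_ge0 ?(ltW r0)// lt_neqAle eq_sym vn0.
  exists w, ((u * r / w) *: a + (v * q / w) *: b); split=> //.
    move/convex_setP: A_convex; apply => //.
    - by rewrite !(divr_ge0, mulr_ge0)// ltW.
    - by rewrite !(divr_ge0, mulr_ge0)// ltW.
    - by rewrite -mulrDl divff// gt_eqF.
  rewrite -!linearZ -linearD; congr (F _).
  have -> : w *: (xbar - ((u * r / w) *: a + (v * q / w) *: b)) =
      (u * r) *: (xbar - a) + (v * q) *: (xbar - b).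
    rewrite scalerBr scalerDr !scalerA ![w * (_ / w)]mulrC !divfK ?gt_eqF//.
    by rewrite !scalerBr addrACA -scalerDl opprD.
  by rewrite (scalerDr u) (scalerDr v) !scalerA addrACA -scalerDl uv scale1r.
have [|_ [r [a [r0 Aa ->]]] Kz] :=
    @minimax _ _ K Z (F d) c (@sphere_hull_compact R Y C)
      (@sphere_hull_convex R Y C) Zconvex ZFd.
  move=> f Kf; have [Wf|nWf] := pselect (W f).
    by exists (F d) => //; exact: Wc.
  have [a Aa fa] : exists2 a, A a & f (F a) < f (F xbar).
    apply: contrapT => h; apply: nWf; apply/multipliersP; split=> // a Aa.
    by rewrite leNgt; apply/negP => fa; apply: h; exists a.
  have e0 : 0 < f (F xbar) - f (F a) by rewrite subr_gt0.
  (* The gain [r * (f (F xbar) - f (F a))] is then [|c - f (F d)| + 1], enough to exceed [c]. *)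
  pose r := (`|c - f (F d)| + 1) / (f (F xbar) - f (F a)).
  have r0 : 0 < r by rewrite divr_gt0// ltr_wpDl.
  exists (F (d + r *: (xbar - a))); first by exists r, a.
  rewrite linearD linearZ linearB dualD dualZ dualB /r divfK ?gt_eqF//.
  by have := ler_norm (c - f (F d)); lra.
(* For [t <= r^-1] the number [t * r] is a convex weight, so the point [b] lies in [A]. *)
exists r^-1; first by rewrite invr_gt0.
move=> t t0 tr.
have tr1 : t * r <= 1 by rewrite -ler_pdivlMr// div1r.
have tr0 : 0 <= t * r by rewrite mulr_ge0// ltW.
pose b := (1 - t * r) *: xbar + (t * r) *: a.
have Ab : A b.
  by move/convex_setP: A_convex; apply; rewrite ?subr_ge0 ?subrK.
apply: (@le_trans _ _ (- oriented_dist C (F (xbar + t *: d) - F b)%R)%E).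
  apply: le_oriented_dist => // f Sf; rewrite -linearB.
  have -> : xbar + t *: d - b = t *: (d + r *: (xbar - a)).
    rewrite /b scalerBl scale1r scalerDr scalerA scalerBr opprD opprB.
    rewrite [xbar + _]addrC -addrA; congr (_ + _).
    by rewrite addrA (addrC xbar) subrK.
  by rewrite linearZ dualZ ler_pM2l//; apply: Kz; exact: sub_sphere_hull.
by apply: ereal_sup_ubound; exists b.
Qed.

Lemma multipliers_neq0 : W !=set0.
Proof.
apply: contrapT => W0.
have [|s s0 h] := @merit_ge 0 1; first by move=> f Wf; case: W0; exists f.
have := h s s0 (lexx _).
by rewrite scaler0 addr0 merit_xbar mulr1 lee_fin leNgt s0.
Qed.

Lemma multipliers_min d : exists m, is_min [set f (F d) | f in W] m.
Proof.
have [f /set_mem Wf fmin] := compact_EVT_min multipliers_neq0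
  multipliers_compact (continuous_subspaceT (@dual_eval_continuous R Y (F d))).
exists (f (F d)); split; first by exists f.
by move=> _ [g Wg <-]; exact/fmin/mem_set.
Qed.

(** The quotient is at most [m] by [merit_le] at a minimizing multiplier, and at least [m - e] for
    small [t] by [merit_ge]; these bounds also make it finite. *)
Lemma merit_diff_quot_cvg d (m : R) : is_min [set f (F d) | f in W] m ->
  diff_quot theta xbar d t @[t --> 0^'+] --> m%:E.
Proof.
move=> [[f0 Wf0 f0m] lbm].
have quot_bounds e : 0 < e -> \forall t \near 0^'+,
    diff_quot theta xbar d t \is a fin_num /\
    m - e <= fine (diff_quot theta xbar d t) <= m.
  move=> e0; have [|s s0 h] := @merit_ge d (m - e).
    by move=> f Wf; apply: (@lt_le_trans _ _ m); [lra|apply: lbm; exists f].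
  near=> t.
  have t0 : 0 < t by near: t; exact: nbhs_right_gt.
  have ts : t <= s by near: t; exact: nbhs_right_le.
  have := h t t0 ts; have := merit_le d Wf0 (ltW t0).
  rewrite /diff_quot merit_xbar sube0 f0m.
  case: (theta _) => [r| |]//; rewrite !lee_fin => rle rge.
  by split=> //=; rewrite ler_pdivlMr// ler_pdivrMr// ![_ * t]mulrC rge.
apply: cvg_EFin.
  by apply: filterS (quot_bounds 1 ltr01) => t [].
apply/cvgrPdist_le => e e0.
apply: filterS (quot_bounds e e0) => t [_ /andP[le1 le2]].
by rewrite ger0_norm /=; lra.
Unshelve. all: by end_near. Qed.

(** * The boundary of the cone defined by the multipliers *)

Lemma pre_dual_cone_closed : closed Wp.
Proof.
rewrite (_ : Wp = \bigcap_(f in W) [set z | 0 <= f z]).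
  apply: closed_bigI => f _.
  apply: (@preimage_closed _ _ (f : Y -> R) [set s | 0 <= s]) => //.
  by move=> z _; exact: dual_continuous.
by [].
Qed.

(** Forms of [K] are 1-Lipschitz, so a positive minimum [m] keeps the ball of radius [m] about [F d]
    in the cone. If the minimum is 0, subtracting a small multiple of a point of [interior C] makes
    the minimizing form negative. *)
Lemma boundary_pre_dual_cone d :
  boundary Wp (F d) <-> is_min [set f (F d) | f in W] 0.
Proof.
have clE : closure Wp = Wp.
  by apply/esym/closure_id; exact: pre_dual_cone_closed.
rewrite /boundary clE; split.
  move=> [Wpd nint]; have [m [[f0 Wf0 f0m] lbm]] := multipliers_min d.
  have [m0|m0] := leP m 0.
    have -> : 0 = m by apply/eqP; rewrite eq_le m0 -f0m Wpd.
    by split=> //; exists f0.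
  case: nint; apply/nbhs_normP; exists m => //= z /= zm f Wf.
  have [Kf _] := (multipliersP f).1 Wf.
  have := sphere_hull_le_norm (F d - z) Kf; rewrite dualB ler_norml => /andP[_].
  by have := lbm (f (F d)) (ex_intro2 _ _ f Wf erefl); lra.
move=> [[f0 Wf0 f00] lb0]; split; first by move=> f Wf; apply: lb0; exists f.
move=> /nbhs_normP[e /= e0 eW]; have [c cint] := C_int.
have [Kf0 _] := (multipliersP f0).1 Wf0.
have c0 := sphere_hull_gt0 cint Kf0.
have n1 : 0 < `|c| + 1 by rewrite ltr_wpDl.
(* This makes [r * |c|] at most [e / 2]; the added 1 keeps the divisor positive. *)
pose r := e / 2 / (`|c| + 1); have r0 : 0 < r by rewrite !divr_gt0.
have /eW/(_ f0 Wf0) : ball_ Num.norm (F d) e (F d - r *: c).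
  rewrite /ball_ /= opprB addrC subrK normrZ gtr0_norm//.
  have : r * (`|c| + 1) = e / 2 by rewrite /r divfK ?gt_eqF.
  by rewrite mulrDr; lra.
by rewrite dualB dualZ f00; have := mulr_gt0 r0 c0; lra.
Qed.

End MeritDerivative.

Theorem theorem5p3 (R : realType) (X Y : completeNormedModType R)
    (A : set X) (C : set Y) (F : {linear X -> Y}) (cF : continuous F)
    (A_neq0 : A !=set0) (A_compact : compact A) (A_convex : convex_set A)
    (C_closed : closed C) (C_convex : convex_set C) (C_cone : is_cone C)
    (C_int : interior C !=set0)
    (F_int : range F `&` interior C !=set0)
    (merit_fin : forall x : X, (merit A C F x < +oo)%E)
    (xbar : X) (xbar_weff : weakly_efficient A C F xbar) :
  let theta := merit A C F in
  let W := multipliers A C cF xbar in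
  let Wp := pre_dual_cone W in
  let D := [set d : X | dir_deriv theta xbar d = 0%E] in
  [/\ (* (i) *)
      forall d : X, dir_derivable theta xbar d /\
        exists2 m : R, is_min [set f (F d) | f in W] m &
          dir_deriv theta xbar d = m%:E,
      (* (ii) *)
      [/\ W !=set0, compact W, convex_set W, C `<=` Wp & Wp `<=` [set: Y]],
      (* (iii) *)
      forall d : X, (dir_deriv theta xbar d < 0)%E <-> ~ Wp (F d)
    & (* (iv) *)
      [/\ is_cone D,
          D = [set d : X | is_min [set f (F d) | f in W] 0]
        & D = F @^-1` boundary Wp]].
Proof.
move=> theta W Wp D.
have min_deriv d m : is_min [set f (F d) | f in W] m ->
    dir_deriv theta xbar d = m%:E.
  move=> mmin; apply: cvg_lim; first exact: ereal_hausdorff.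
  exact: merit_diff_quot_cvg.
have min_ex d : exists m, is_min [set f (F d) | f in W] m.
  exact: multipliers_min.
(* The derivative is the attained minimum, so it vanishes exactly when that minimum is 0. *)
have DE : D = [set d : X | is_min [set f (F d) | f in W] 0].
  apply/seteqP; split=> d; last exact: min_deriv.
  have [m mmin] := min_ex d.
  by rewrite /D /= (min_deriv d m)// => -[<-].
split.
- move=> d; have [m mmin] := min_ex d; split.
    by apply/cvg_ex; exists m%:E; exact: merit_diff_quot_cvg.
  by exists m => //; exact: min_deriv.
- split=> //.
  + exact: multipliers_neq0.
  + exact: multipliers_compact.
  + exact: multipliers_convex.
  + by move=> c Cc f /multipliersP[Kf _]; exact: sphere_hull_ge0 Kf Cc.
- move=> d; have [m mmin] := min_ex d; rewrite (min_deriv d m)// lte_fin.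
  have [[f0 Wf0 f0m] lbm] := mmin; split.
    by move=> m0 /(_ f0 Wf0); rewrite f0m leNgt m0.
  move=> nWp; rewrite ltNge; apply/negP => m0; apply: nWp => f Wf.
  by apply: (le_trans m0); apply: lbm; exists f.
- split=> //.
    (* Scaling [d] by [t >= 0] scales the value of every multiplier, so a zero minimum persists. *)
    rewrite DE => t d t0 /= [[f0 Wf0 f00] lb0]; split.
      by exists f0 => //; rewrite linearZ dualZ f00 mulr0.
    move=> _ [f Wf <-]; rewrite linearZ dualZ mulr_ge0//.
    by apply: lb0; exists f.
  by rewrite DE; apply/seteqP; split=> d /= /boundary_pre_dual_cone; exact.
Qed.
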